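(* Let $(X,\Psi_t,\nu)$ be a flow on a manifold $X$ with distance $d$, preserving a Borel probability measure $\nu$. Assume that the flow has bounded speed, i.e. there is $K\ge0$ such that $d(\Psi_t(x),\Psi_{t+T}(x))\le KT$ for all $x$, all $t$ and all $T>0$, and that the flow is Lipschitz, i.e. there is $L>0$ such that $d(\Psi_t(x),\Psi_t(y))\le L^t d(x,y)$ for all $x,y\in X$ and $t\ge 0$. Then $$\limsup_{t\to+\infty}\frac{\log\mathbb{M}_{\Psi,t}(x,y)}{-\log t}\le\frac{2}{\underline{C}_\nu-1}\qquad\text{for }\nu\times\nu\text{-a.e. }(x,y).$$
   Context: For $t>0$ and $x,y\in X$, $\mathbb{M}_{\Psi,t}(x,y)=\min_{0\le t_1,t_2<t}d(\Psi_{t_1}(x),\Psi_{t_2}(y))$ is the shortest distance between the two orbits up to time $t$. The lower correlation dimension of $\nu$ is $\underline{C}_\nu=\liminf_{r\to0}\frac{\log\int\nu(B(x,r))\,d\nu(x)}{\log r}$, where $B(x,r)$ is the ball of centre $x$ and radius $r$.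
   Formalization: The lower correlation dimension is assumed to be at least 1 (with 2/0 read as +∞): below 1 the right-hand side is negative while the limsup is always ≥ 0, so the claim fails (e.g. a Dirac mass at a fixed point). The minimum defining M is read as an infimum. *)

(* Defs.v *)
From HB Require Import structures.
From mathcomp Require Import all_boot all_order all_algebra.
From mathcomp Require Import all_classical all_reals all_analysis.

Set Implicit Arguments.
Unset Strict Implicit.
Unset Printing Implicit Defensive.

Import Order.TTheory GRing.Theory Num.Theory.
Import numFieldTopology.Exports.

Local Open Scope classical_set_scope.
Local Open Scope ring_scope.

(* Measurable types are pointed in the library, so a metric space needs a
   distinguished point to carry its Borel sigma-algebra. *)
#[short(type="pmetricType")]
HB.structure Definition PointedMetric (R : numDomainType) :=
  { M of Metric R M & isPointed M }.

Notation borelType X := (g_sigma_algebraType (@open X)).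

Section manifold.
Context {R : realType} {X : metricType R}.

(* The functions f and g are only relevant on U and V, where they are mutually
   inverse homeomorphisms. *)
Definition locally_euclidean (n : nat) : Prop :=
  forall x : X, exists (U : set X) (V : set 'rV[R]_n)
    (f : X -> 'rV[R]_n) (g : 'rV[R]_n -> X),
    [/\ open U, U x & open V] /\
    [/\ f @` U `<=` V, g @` V `<=` U,
        (forall u, U u -> g (f u) = u) & (forall v, V v -> f (g v) = v)] /\
    {within U, continuous f} /\ {within V, continuous g}.

(* The topology is the one of the distance, hence Hausdorff. *)
Definition manifold (n : nat) : Prop :=
  @second_countable X /\ locally_euclidean n.

End manifold.

Arguments locally_euclidean {R} X n.
Arguments manifold {R} X n.

Section flow.
Context {R : realType}.

Definition flow {X : Type} (Psi : R -> X -> X) : Prop :=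
  (forall x, Psi 0 x = x) /\
  (forall s t x, Psi (s + t) x = Psi s (Psi t x)).

Definition flow_preserves {d} {T : measurableType d}
    (nu : set T -> \bar R) (Psi : R -> T -> T) : Prop :=
  forall t, measurable_fun [set: T] (Psi t) /\
    (forall A, measurable A -> nu (Psi t @^-1` A) = nu A).

Context {X : metricType R}.
Implicit Type Psi : R -> X -> X.

Definition bounded_speed Psi : Prop :=
  exists2 K : R, 0 <= K &
    forall x t T, 0 < T -> mdist (Psi t x) (Psi (t + T) x) <= K * T.

Definition lipschitz_flow Psi : Prop :=
  exists2 L : R, 0 < L &
    forall x y t, 0 <= t -> mdist (Psi t x) (Psi t y) <= L `^ t * mdist x y.

(* An infimum, since a minimum over half-open intervals need not be attained. *)
Definition shortest_distance Psi (t : R) (x y : X) : R :=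
  inf [set mdist (Psi t1 x) (Psi t2 y) | t1 in `[0, t[ & t2 in `[0, t[].

End flow.

Section correlation_dimension.
Context {R : realType} {X : pmetricType R}.
Local Open Scope ereal_scope.

(* lne is the logarithm on [0, +oo], with lne 0 = -oo. *)
Definition lower_correlation_dimension (nu : probability (borelType X) R) :
    \bar R :=
  limf_einf
    (fun r : R => lne (\int[nu]_x nu (ball (x : X) r)) / (ln r)%:E) 0%R^'+.

End correlation_dimension.

(* Main.v *)
(* If two orbits come within r at times t1, t2 < T, push both forward by the
   same time s <= 1 so that t1 + s is an integer i: the Lipschitz hypothesis
   keeps them O(r)-close, and bounded speed then allows t2 + s to be rounded to
   a multiple of r.  Only O(T) * O(T / r) pairs of times remain (instead of
   (T / r)^2 if both times were rounded to multiples of r), and by invariance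
   each pair contributes measure \int nu(B(x, O(r))) = O(r^c) for c below the
   correlation dimension.  With r = T^(-a) the total O(T^(2 - a (c - 1))) is
   summable along T = 2^n as soon as a (c - 1) > 2, and Borel-Cantelli
   concludes, by monotonicity of the shortest distance in t. *)
Require Import Defs.
From HB Require Import structures.
From mathcomp Require Import all_boot all_order all_algebra.
From mathcomp Require Import all_classical all_reals all_analysis.
From mathcomp Require Import ring lra.

Set Implicit Arguments.
Unset Strict Implicit.
Unset Printing Implicit Defensive.

Import Order.TTheory GRing.Theory Num.Theory.
Import numFieldTopology.Exports.

Local Open Scope classical_set_scope.
Local Open Scope ring_scope.
Local Open Scope ereal_scope.

(** * Measurability and invariance in the product space *)

(** A countable basis writes an open set of the product as a countable union of basic rectangles,
    each in the product sigma-algebra. *)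
Lemma open_prod_measurable (R : realType) (X : pmetricType R)
    (A : set (borelType X * borelType X)) :
  @second_countable X -> (open (A : set (X * X)%type)) -> measurable A.
Proof.
move=> [B /countable_injP[f finj] [Bo Bb]] oA.
(* [U n] is the basic open set with code [n], or empty if there is none. *)
pose U n : set X := \bigcup_(b in [set b | B b /\ f b = n]) b.
have mU n : measurable (U n : set (borelType X)).
  by apply: sub_sigma_algebra; apply: bigcup_open => b [/Bo].
have UE b : B b -> U (f b) = b.
  move=> Bb'; apply/seteqP; split=> [x [b' [Bb'' /finj]] |x bx].
    by rewrite !inE => ->.
  by exists b.
have -> : A = \bigcup_m \bigcup_n
    (if `[< U m `*` U n `<=` A >] then U m `*` U n else set0).
  apply/seteqP; split=> [[x y] Axy|p [m _ [n _]]]; last first.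
    by case: ifPn => // /asboolP; exact.
  have [[V W] /= [Vx Wy] VWA] : nbhs ((x, y) : X * X) A by exact: open_nbhs_nbhs.
  have [b [Bb1 bx] bV] := Bb x _ Vx; have [b' [Bb2 by'] bW] := Bb y _ Wy.
  exists (f b) => //; exists (f b') => //.
  rewrite !UE//; case: ifPn => [_ //|/asboolP]; case => -[u v] [/= bu bv].
  by apply: VWA; split; [exact: bV|exact: bW].
apply: bigcupT_measurable => m; apply: bigcupT_measurable => n.
by case: ifPn => // _; exact: measurableX.
Qed.

Lemma measurable_dist_lt (R : realType) (X : pmetricType R) (r : R) :
  @second_countable X ->
  measurable [set p : borelType X * borelType X | (mdist (p.1 : X) p.2 < r)%R].
Proof.
move=> X2; apply: open_prod_measurable => //.
rewrite openE => -[x y] /= xyr.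
pose e := ((r - mdist x y) / 2)%R.
have e0 : (0 < e)%R by rewrite divr_gt0// subr_gt0.
exists (ball x e, ball y e); first by split; exact: nbhsx_ballx.
move=> [u v] []; rewrite !ballEmdist/= => xu yv.
have -> : r = (e + mdist x y + e)%R by rewrite /e; field.
rewrite (le_lt_trans (metric_triangle u y v))// ltrD//.
by rewrite (le_lt_trans (metric_triangle u x y))// ltrD2r metric_sym.
Qed.

(** Integrate the measures of the sections: invariance under [g] removes [g] inside each section,
    then invariance under [f] is a change of variables in the outer integral. *)
Lemma product_measure1_preserved d1 d2 (T1 : measurableType d1) (T2 : measurableType d2)
    (R : realType) (m1 : {measure set T1 -> \bar R})
    (m2 : {sigma_finite_measure set T2 -> \bar R}) (f : T1 -> T1) (g : T2 -> T2)
    (A : set (T1 * T2)) :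
  measurable_fun setT f ->
  (forall B, measurable B -> m1 (f @^-1` B) = m1 B) ->
  (forall B, measurable B -> m2 (g @^-1` B) = m2 B) ->
  measurable A ->
  (m1 \x m2) [set p | A (f p.1, g p.2)] = (m1 \x m2) A.
Proof.
move=> mf fm1 gm2 mA; rewrite /product_measure1.
transitivity (\int[m1]_x ((m2 \o xsection A) \o f) x).
  apply: eq_integral => x _ /=.
  rewrite -(gm2 (xsection A (f x))); last exact: measurable_xsection.
  by congr (m2 _); apply/seteqP; split=> y; rewrite /xsection /= !inE.
have mA2 := measurable_fun_xsection m2 mA.
rewrite -[X in \int[_]_(x in X) _](preimage_setT f) -ge0_integral_pushforward//.
apply: eq_measure_integral => B mB _.
exact: fm1.
Qed.

(** * Power-law decay from a lower limit of logarithms *)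

Lemma limf_einf_ge_div_ln (R : realType) (f : R -> R) (c : R) :
  (forall r, (0 <= f r <= 1)%R) -> (0 <= c)%R ->
  c%:E < limf_einf (fun r => lne (f r)%:E / (ln r)%:E) 0%R^'+ ->
  exists2 C : R, (0 < C)%R & forall r, (0 < r)%R -> (f r <= C * r `^ c)%R.
Proof.
move=> f01 c0; rewrite limf_einfE => /ereal_sup_gt[_ [A nA <-] cA].
have [e /= e0 eA] := nA.
pose s : R := Num.min e (1 / 2)%R.
have s0 : (0 < s)%R by rewrite lt_min e0 divr_gt0.
have s1 : (s < 1)%R by rewrite gt_min; apply/orP; right; lra.
(* The 1 serves [r < s]; the other term serves [r >= s], where [f r <= 1] and [r]^ c >= s [^ c]. *)
exists (Num.max 1 (s `^ c)^-1)%R; first by rewrite lt_max ltr01.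
move=> r r0; have [rs|sr] := ltP r s; last first.
  have sc0 : (0 < s `^ c)%R by exact: powR_gt0.
  apply: (@le_trans _ _ ((s `^ c)^-1 * r `^ c)%R); last first.
    by rewrite ler_wpM2r ?powR_ge0// le_max lexx orbT.
  apply: (@le_trans _ _ 1%R); first by have /andP[] := f01 r.
  rewrite mulrC ler_pdivlMr// mul1r.
  by apply: ge0_ler_powR => //; rewrite nnegrE ltW.
apply: (@le_trans _ _ (r `^ c)%R); last first.
  by rewrite ler_peMl ?powR_ge0// le_max lexx.
have Ar : A r.
  apply: eA => //=; rewrite sub0r normrN gtr0_norm//.
  by rewrite (lt_le_trans rs)// ge_min lexx.
have lr0 : (ln r < 0)%R by rewrite ln_lt0// r0/= (lt_trans rs).
have {cA} : c%:E <= lne (f r)%:E / (ln r)%:E.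
  by rewrite (le_trans (ltW cA))//; apply: ereal_inf_lbound; exists r.
rewrite inver lt_eqF// lee_ndivlMr//.
have [fr0|fr0] := leP (f r) 0%R; first by rewrite (le_trans fr0)// powR_ge0.
rewrite lne_EFin// -EFinM lee_fin -ln_powR ler_ln// posrE//.
by rewrite powR_gt0.
Qed.

(** * Discretisation of the meeting times *)

Lemma orbits_meet_on_grid (R : realType) (X : pmetricType R) (Psi : R -> X -> X)
    (K L : R) (x y : X) (r t1 t2 : R) (T : nat) :
  flow Psi -> (0 <= K)%R -> (0 < L)%R ->
  (forall x t s, 0 < s -> mdist (Psi t x) (Psi (t + s) x) <= K * s)%R ->
  (forall x y t, 0 <= t -> mdist (Psi t x) (Psi t y) <= L `^ t * mdist x y)%R ->
  (0 < r)%R -> (0 <= t1 < T%:R)%R -> (0 <= t2 < T%:R)%R ->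
  (mdist (Psi t1 x) (Psi t2 y) < r)%R ->
  exists i j : nat, [/\ (i <= T)%N, (j%:R * r <= T%:R + 1)%R &
    (mdist (Psi i%:R x) (Psi (j%:R * r) y) < (Num.max 1 L + K) * r)%R].
Proof.
move=> [_ PsiD] K0 L0 speed lip r0 /andP[t10 t1T] /andP[t20 t2T] xyr.
(* The shift [s] lies in (0, 1], and [i <= T] because [t1 < T] with [T] an integer. *)
pose i := (Num.truncn t1).+1; pose s : R := (i%:R - t1)%R.
have s0 : (0 < s)%R by rewrite subr_gt0 truncnS_gt.
have s1 : (s <= 1)%R.
  by rewrite lerBlDr addrC /i -natr1 lerD2r truncn_le.
pose u : R := (s + t2)%R; have u0 : (0 <= u)%R by rewrite addr_ge0// ltW.
pose j := Num.truncn (u / r).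
have ur0 : (0 <= u / r)%R by rewrite divr_ge0// ltW.
have jr : (j%:R * r <= u)%R by rewrite -ler_pdivlMr// truncn_le.
have ju : (u - j%:R * r <= r)%R.
  rewrite lerBlDr -[X in (X + _)%R]mul1r -mulrDl -ler_pdivrMr//.
  by rewrite addrC natr1 ltW// truncnS_gt.
exists i, j; split.
- by rewrite /i truncn_lt_nat.
- by rewrite (le_trans jr)// addrC lerD// ltW.
have Ls : (L `^ s <= Num.max 1 L)%R.
  have [L1|L1] := leP 1%R L; first by rewrite ler1_powR.
  by rewrite -(powRr0 L); apply: ger_powR; [rewrite L0 ltW|exact: ltW].
have near_i : (mdist (Psi i%:R x) (Psi u y) < Num.max 1 L * r)%R.
  have -> : Psi i%:R x = Psi s (Psi t1 x) by rewrite -PsiD subrK.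
  have -> : Psi u y = Psi s (Psi t2 y) by exact: PsiD.
  rewrite (le_lt_trans (lip _ _ _ (ltW s0)))//.
  rewrite (@le_lt_trans _ _ (Num.max 1 L * mdist (Psi t1 x) (Psi t2 y))%R)//.
    by rewrite ler_wpM2r// mdist_ge0.
  by rewrite ltr_pM2l// lt_max ltr01.
rewrite mulrDl (le_lt_trans (metric_triangle _ (Psi u y) _))// ltr_leD//.
(* Bounded speed is assumed for positive durations only, so a time already on the grid is treated
   apart. *)
rewrite metric_sym; have [->|uj] := eqVneq u (j%:R * r)%R.
  by rewrite mdistxx mulr_ge0// ltW.
rewrite -[in leLHS](subrKC (j%:R * r)%R u) (le_trans (speed _ _ _ _))//.
  by rewrite subr_gt0 lt_neqAle eq_sym uj.
by rewrite ler_wpM2l.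
Qed.

(** * Measure estimates and Borel-Cantelli *)

Lemma measure_bigsetU_le d (T : measurableType d) (R : realType)
    (mu : {measure set T -> \bar R}) (A : (set T)^nat) (n : nat) (M : R) :
  (forall i, (i < n)%N -> measurable (A i)) ->
  (forall i, (i < n)%N -> mu (A i) <= M%:E) ->
  mu (\big[setU/set0]_(i < n) A i) <= (n%:R * M)%:E.
Proof.
move=> mA AM; rewrite (le_trans (Boole_inequality mu mA))//.
have -> : (n%:R * M)%R = (\sum_(i < n) M)%R by rewrite sumr_const card_ord mulr_natl.
by rewrite -sumEFin; apply: lee_sum => i _; exact: AM.
Qed.

(** Invariance removes [f] and [g]; what remains is the measure of a neighbourhood of the diagonal,
    whose sections are balls. *)
Lemma product_measure1_dist_lt (R : realType) (X : pmetricType R)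
    (nu : probability (borelType X) R) (f g : borelType X -> borelType X) (r : R) :
  @second_countable X ->
  measurable_fun setT f -> measurable_fun setT g ->
  (forall B, measurable B -> nu (f @^-1` B) = nu B) ->
  (forall B, measurable B -> nu (g @^-1` B) = nu B) ->
  let D := [set p : borelType X * borelType X |
             (mdist (f p.1 : X) (g p.2) < r)%R] in
  measurable D /\ (nu \x nu) D = \int[nu]_x nu (ball (x : X) r).
Proof.
move=> X2 mf mg fnu gnu D.
have mD0 := @measurable_dist_lt R X r X2.
split.
  rewrite -[D]setTI.
  have mfg : measurable_fun setT (fun p : borelType X * borelType X => (f p.1, g p.2)).
    by apply: measurable_fun_pair; apply: measurableT_comp.
  exact: (mfg measurableT _ mD0).
have := product_measure1_preserved mf fnu gnu mD0.
rewrite -/D => ->.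
apply: eq_integral => x _ /=; congr (nu _).
by apply/seteqP; split=> y; rewrite /xsection /= !inE /= ballEmdist.
Qed.

(** Borel-Cantelli at times [2 ^ n.+1] and scales [q ^+ n]. With [q = 2]^ (- a)[, the condition on]4
    * q [^ c / q] says [a * (c - 1) > 2]. *)
Lemma ae_orbits_separated (R : realType) (X : pmetricType R)
    (Psi : R -> X -> X) (nu : probability (borelType X) R) (C c q : R) :
  @second_countable X -> flow Psi ->
  flow_preserves nu (Psi : R -> borelType X -> borelType X) ->
  bounded_speed Psi -> lipschitz_flow Psi ->
  (0 < C)%R ->
  (forall r, (0 < r)%R -> \int[nu]_x nu (ball (x : X) r) <= (C * r `^ c)%:E) ->
  (0 < q < 1)%R -> (4 * q `^ c / q < 1)%R ->
  {ae (nu \x nu), forall p : borelType X * borelType X, exists N : nat,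
    forall n, (N <= n)%N -> forall t1 t2, (0 <= t1 < (2 ^ n.+1)%:R)%R ->
      (0 <= t2 < (2 ^ n.+1)%:R)%R ->
      (q ^+ n <= mdist (Psi t1 p.1) (Psi t2 p.2))%R}.
Proof.
move=> X2 fl pres [K K0 speed] [L L0 lip] C0 corr /andP[q0 q1] z1.
pose H : R := (Num.max 1 L + K)%R.
have H0 : (0 < H)%R by rewrite ltr_wpDr// lt_max ltr01.
pose D n (i j : nat) := [set p : borelType X * borelType X |
  (mdist (Psi i%:R p.1) (Psi (j%:R * q ^+ n) p.2) < H * q ^+ n)%R].
(* [m n] counts the [j] with [j * q ^+ n <= 2 ^ n.+1 + 1]; in [F], the range [i < 2 ^ n.+2] covers
   all [i <= 2 ^ n.+1]. *)
pose m n := (Num.truncn (((2 ^ n.+1)%:R + 1) / q ^+ n : R)).+1.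
pose F n := \big[setU/set0]_(i < 2 ^ n.+2) \big[setU/set0]_(j < m n) D n i j.
have mD n i j : measurable (D n i j) /\ 
    (nu \x nu) (D n i j) <= (C * (H * q ^+ n) `^ c)%:E.
  have [m1 p1] := pres i%:R; have [m2 p2] := pres (j%:R * q ^+ n)%R.
  have [mD ->] := product_measure1_dist_lt (H * q ^+ n)%R X2 m1 m2 p1 p2.
  by split => //; apply: corr; rewrite mulr_gt0// exprn_gt0.
have mDj n i : measurable (\big[setU/set0]_(j < m n) D n i j).
  by apply: bigsetU_measurable => j _; have [] := mD n i j.
have mF n : measurable (F n) by apply: bigsetU_measurable => i _.
pose z := (4 * q `^ c / q)%R.
pose A := (32 * C * H `^ c)%R.
have A0 : (0 < A)%R by rewrite !mulr_gt0// powR_gt0.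
have z0 : (0 < z)%R by rewrite divr_gt0// mulr_gt0// powR_gt0.
have FA n : (nu \x nu) (F n) <= (geometric A z n)%:E.
  have qn0 : (0 < q ^+ n)%R by rewrite exprn_gt0.
  have qn1 : (q ^+ n <= 1)%R by rewrite exprn_ile1// ltW.
  apply: (@le_trans _ _ ((2 ^ n.+2)%:R * ((m n)%:R * (C * (H * q ^+ n) `^ c)))%:E).
    apply: (@measure_bigsetU_le _ _ _ (nu \x nu)
      (fun i => \big[setU/set0]_(j < m n) D n i j)) => i _; first exact: mDj.
    apply: (@measure_bigsetU_le _ _ _ (nu \x nu) (D n i)) => j _.
      by have [] := mD n i j.
    by have [] := mD n i j.
  rewrite lee_fin /geometric /=.
  have -> : ((H * q ^+ n) `^ c = H `^ c * (q `^ c) ^+ n)%R.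
    rewrite powRM ?ltW// -!powR_mulrn ?powR_ge0 ?ltW//.
    by rewrite powRAC.
  have mn : ((m n)%:R <= 8 * 2 ^+ n / q ^+ n :> R)%R.
    rewrite ler_pdivlMr// /m -natr1 mulrDl mul1r.
    have : ((Num.truncn (((2 ^ n.+1)%:R + 1) / q ^+ n : R))%:R * q ^+ n <= (2 ^ n.+1)%:R + 1 :> R)%R.
      by rewrite -ler_pdivlMr// truncn_le divr_ge0// ltW.
    have : (1 <= 2 ^+ n :> R)%R by rewrite exprn_ege1// ler1n.
    rewrite natrX exprS; lra.
  have -> : (A * z ^+ n = (2 ^ n.+2)%:R * ((8 * 2 ^+ n / q ^+ n) * (C * (H `^ c * (q `^ c) ^+ n))))%R.
    rewrite /A /z natrX !exprMn exprVn !exprS (_ : 4 = 2 * 2)%R ?exprMn; last by ring.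
    by field; rewrite gt_eqF.
  rewrite ler_wpM2l// ler_wpM2r// !mulr_ge0 ?powR_ge0 ?exprn_ge0 ?powR_ge0// ltW//.
have sumF : \sum_(0 <= n <oo) (nu \x nu) (F n) < +oo.
  apply: (@le_lt_trans _ _ (A / (1 - z))%:E); last exact: ltry.
  apply: lime_le; first exact: is_cvg_nneseries.
  apply: nearW => N.
  apply: (@le_trans _ _ (series (geometric A z) N)%:E); last first.
    by rewrite lee_fin geometric_le_lim ?ger0_norm// ltW.
  by rewrite /series/= -sumEFin; apply: lee_sum.
(* A pair outside this null set avoids [F n] for all large [n]; an encounter at scale [q ^+ n] would
   put it in [F n]. *)
exists (lim_sup_set F); split.
- by apply: bigcapT_measurable => n; apply: bigcup_measurable => k _.
- exact: lim_sup_set_cvg0.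
move=> [x y] /= nsep N _.
apply: contrapT => nF; apply: nsep; exists N => n Nn t1 t2 t1n t2n.
rewrite leNgt; apply/negP => xy; apply: nF; exists n => //.
have qn0 : (0 < q ^+ n)%R by rewrite exprn_gt0.
have [i [j [iT jT Dij]]] := orbits_meet_on_grid fl K0 L0 speed lip qn0 t1n t2n xy.
rewrite /F -(bigcup_mkord _ (fun i => \big[setU/set0]_(j < m n) D n i j)).
exists i => /=; first by rewrite (leq_ltn_trans iT)// ltn_exp2l.
rewrite -(bigcup_mkord _ (D n i)); exists j => //=.
rewrite /m ltnS truncn_ge_nat; first by rewrite ler_pdivlMr.
by rewrite divr_ge0// ltW.
Qed.

(** * Correlation dimension and the limit of large times *)

Lemma correlation_integral_le_powR (R : realType) (X : pmetricType R)
    (nu : probability (borelType X) R) (c : R) :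
  @second_countable X -> (0 <= c)%R -> c%:E < lower_correlation_dimension nu ->
  exists2 C : R, (0 < C)%R & forall r, (0 < r)%R ->
    \int[nu]_x nu (ball (x : X) r) <= (C * r `^ c)%:E.
Proof.
move=> X2 c0.
have I01 r : 0 <= \int[nu]_x nu (ball (x : X) r) <= 1.
  apply/andP; split; first exact: integral_ge0.
  have mid := @measurable_id _ (borelType X) setT.
  (* With identity maps, the correlation integral is the product measure of a set, hence at most
     1. *)
  have [mD <-] := @product_measure1_dist_lt R X nu idfun idfun r X2 mid mid (fun _ _ => erefl) (fun _ _ => erefl).
  rewrite (@le_trans _ _ ((nu \x nu) (setT `*` setT)))//.
    by rewrite le_measure// ?inE// setXTT.
  rewrite product_measure1E// -[leRHS]mule1.
  by apply: lee_pmul => //; exact: probability_le1.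
pose f r := fine (\int[nu]_x nu (ball (x : X) r)).
have fE r : \int[nu]_x nu (ball (x : X) r) = (f r)%:E.
  have /andP[I0 I1] := I01 r; rewrite /f fineK// ge0_fin_numE//.
  by rewrite (le_lt_trans I1)// ltry.
have f01 r : (0 <= f r <= 1)%R by rewrite -!lee_fin -fE.
rewrite /lower_correlation_dimension; under eq_fun do rewrite fE.
move=> /(limf_einf_ge_div_ln f01 c0)[C C0 fC]; exists C => // r r0.
by rewrite fE lee_fin fC.
Qed.

(** For [2 ^ n <= t < 2 ^ n.+1], the orbits up to time [t] are covered by the bound at [2 ^ n.+1],
    and [(2 ^ n)]^ (- a) >= t [^ (- a)]. *)
Lemma limf_esup_shortest_distance_le (R : realType) (X : pmetricType R)
    (Psi : R -> X -> X) (x y : X) (a : R) (N : nat) : (0 <= a)%R ->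
  (forall n, (N <= n)%N -> forall t1 t2, (0 <= t1 < (2 ^ n.+1)%:R)%R ->
      (0 <= t2 < (2 ^ n.+1)%:R)%R ->
      ((2 `^ (- a)) ^+ n <= mdist (Psi t1 x) (Psi t2 y))%R) ->
  limf_esup (fun t : R => lne (shortest_distance Psi t x y)%:E / (- ln t)%:E)
    (+oo%R : set_system R) <= a%:E.
Proof.
move=> a0 sep.
(* This threshold gives both [n >= N] and [t >= 2], so that [ln t > 0]. *)
pose V := [set t : R | ((2 ^ N.+1)%:R <= t)%R].
apply: (@le_trans _ _ (ereal_sup [set lne (shortest_distance Psi t x y)%:E / (- ln t)%:E | t in V])).
  by apply: ereal_inf_lbound; exists V => //; apply: nbhs_pinfty_ge; exact: num_real.
apply: ge_ereal_sup => _ [t Vt <-].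
have Nt : ((2 ^ N)%:R <= t)%R by rewrite (le_trans _ Vt)// ler_nat leq_exp2l.
have t2 : (2 <= t)%R.
  by rewrite (le_trans _ Vt)// (ler_nat _ 2) expnS leq_pmulr// expn_gt0.
have t0 : (0 < t)%R by rewrite (lt_le_trans _ t2).
have T0 : (0 < Num.truncn t)%N by rewrite truncn_gt0 (le_trans _ t2)// ler1n.
pose n := trunc_log 2 (Num.truncn t).
have /andP[nt tn] : ((2 ^ n)%:R <= t < (2 ^ n.+1)%:R)%R.
  have /andP[lo hi] := @trunc_log_bounds 2 _ isT T0.
  by rewrite -truncn_ge_nat ?ltW// lo -truncn_lt_nat ?ltW.
have Nn : (N <= n)%N by rewrite trunc_log_max// truncn_ge_nat// ltW.
have sd : (t `^ (- a) <= shortest_distance Psi t x y)%R.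
  apply: lb_le_inf.
    exists (mdist (Psi 0%R x) (Psi 0%R y)); have t00 : `[0%R, t[%classic 0%R by rewrite /= in_itv/= lexx.
    by exists 0%R => //; exists 0%R.
  move=> _ [t1 /= t1t [t2' /= t2t <-]].
  rewrite !in_itv/= in t1t t2t; case/andP: t1t => t10 t1t; case/andP: t2t => t20 t2t.
  apply: le_trans (sep n Nn t1 t2' _ _); last 2 first.
  - by rewrite t10 (lt_trans t1t).
  - by rewrite t20 (lt_trans t2t).
  rewrite -powR_mulrn ?powR_ge0// powRAC powR_mulrn// -natrX !powRN.
  rewrite lef_pV2 ?posrE ?powR_gt0// ?ltr0n ?expn_gt0//.
  by apply: ge0_ler_powR => //; rewrite nnegrE ltW.
have sd0 := lt_le_trans (powR_gt0 (- a) t0) sd.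
have lt0 : (- ln t < 0)%R by rewrite oppr_lt0 ln_gt0// (lt_le_trans _ t2)// ltr1n.
rewrite inver lt_eqF// lee_ndivrMr// lne_EFin// -EFinM lee_fin mulrN -mulNr -ln_powR.
by rewrite ler_ln// posrE// powR_gt0.
Qed.

Lemma ae_limf_esup_shortest_distance_le (R : realType) (X : pmetricType R)
    (Psi : R -> X -> X) (nu : probability (borelType X) R) (a : R) :
  @second_countable X -> flow Psi ->
  flow_preserves nu (Psi : R -> borelType X -> borelType X) ->
  bounded_speed Psi -> lipschitz_flow Psi ->
  (0 < a)%R -> (1 + 2 / a)%:E < lower_correlation_dimension nu ->
  {ae (nu \x nu), forall p : borelType X * borelType X,
     limf_esup
       (fun t : R => lne (shortest_distance Psi t p.1 p.2)%:E / (- ln t)%:E)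
       (+oo%R : set_system R) <= a%:E}.
Proof.
move=> X2 fl pres speed lip a0 aC.
(* The strict hypothesis leaves room for a real exponent [c] below the dimension, which may be
   infinite. *)
have [c ac cC] : exists2 c, (1 + 2 / a < c)%R & c%:E < lower_correlation_dimension nu.
  move: aC; case: lower_correlation_dimension => [r| |] // aC.
    by exists ((1 + 2 / a + r) / 2)%R; rewrite lte_fin in aC; rewrite ?lte_fin; lra.
  by exists (1 + 2 / a + 1)%R; rewrite ?ltry//; lra.
have c0 : (0 <= c)%R by rewrite (le_trans _ (ltW ac))// addr_ge0// divr_ge0// ltW.
have [C C0 IC] := correlation_integral_le_powR X2 c0 cC.
have q01 : (0 < (2 : R) `^ (- a) < 1)%R.
  rewrite powR_gt0//= -[ltRHS](powRr0 2).
  by rewrite /powR pnatr_eq0/= ltr_expR ltr_pM2r ?ln_gt0 ?ltr1n// oppr_lt0.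
have z1 : (4 * (2 `^ (- a)) `^ c / 2 `^ (- a) < 1 :> R)%R.
  have -> : (4 = 2 `^ 2 :> R)%R by rewrite powR_mulrn//; ring.
  rewrite -powRrM -powRN -!powRD ?pnatr_eq0 ?implybT// -[ltRHS](powRr0 2).
  rewrite /powR pnatr_eq0/= ltr_expR ltr_pM2r ?ln_gt0 ?ltr1n//.
  (* The ratio equals 2 to the power [2 - a * (c - 1)]. *)
  suff : (2 < a * (c - 1))%R by lra.
  by rewrite mulrC -ltr_pdivrMr// ltrBrDl.
have := ae_orbits_separated X2 fl pres speed lip C0 IC q01 z1.
apply: filterS => p [N sep].
exact: (limf_esup_shortest_distance_le (ltW a0) sep).
Qed.

Theorem theorem4p1 (R : realType) (n : nat) (X : pmetricType R)
    (hX : manifold X n)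
    (Psi : R -> X -> X) (nu : probability (borelType X) R)
    (hflow : flow Psi)
    (hnu : flow_preserves nu (Psi : R -> borelType X -> borelType X))
    (hspeed : bounded_speed Psi)
    (hlip : lipschitz_flow Psi)
    (hC : 1 <= lower_correlation_dimension nu) :
  {ae (nu \x nu), forall p : borelType X * borelType X,
     limf_esup
       (fun t : R =>
          lne (shortest_distance Psi t p.1 p.2)%:E / (- ln t)%:E) (+oo%R : set_system R)
     <= 2%:E / (lower_correlation_dimension nu - 1)}.
Proof.
have [X2 _] := hX.
(* In dimension 1 the bound is 2 times the inverse of 0, that is [+oo]. *)
have [C1|C1] := eqVneq (lower_correlation_dimension nu) 1.
  apply: aeW => p; rewrite C1 subee// inve0 gt0_muley ?lte_fin//.
  exact: leey.
have {hC} C1 : 1 < lower_correlation_dimension nu by rewrite lt_neqAle eq_sym C1.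
(* [b] is the bound as a real number, 0 if the dimension is infinite; every [a > b] meets the
   hypothesis of the previous lemma. *)
have [b [b0 -> bC]] : exists b : R, [/\ (0 <= b)%R,
    2%:E / (lower_correlation_dimension nu - 1) = b%:E &
    forall a, (b < a)%R -> (1 + 2 / a)%:E < lower_correlation_dimension nu].
  move: C1; case: lower_correlation_dimension => [r| |] // r1; last first.
    by exists 0%R; split => // [|a _]; [rewrite /= invey mule0|exact: ltry].
  rewrite lte_fin in r1; have r10 : (0 < r - 1)%R by rewrite subr_gt0.
  exists (2 / (r - 1))%R; split; first by rewrite divr_ge0// ltW.
    by rewrite -EFinB inver gt_eqF.
  move=> a ba; have a0 : (0 < a)%R by rewrite (lt_trans _ ba)// divr_gt0.
  by rewrite lte_fin -ltrBrDl ltr_pdivrMr// mulrC -ltr_pdivrMr.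
(* The exceptional set depends on [a], so [a] decreases to [b] along a sequence, and countably many
   null sets are discarded. *)
have /ae_foralln : forall k : nat, {ae (nu \x nu), forall p : borelType X * borelType X,
     limf_esup
       (fun t : R =>
          lne (shortest_distance Psi t p.1 p.2)%:E / (- ln t)%:E) (+oo%R : set_system R)
     <= (b + k.+1%:R^-1)%:E}.
  move=> k; have bk : (b < b + k.+1%:R^-1)%R by rewrite ltrDl invr_gt0.
  by apply: ae_limf_esup_shortest_distance_le => //; [exact: le_lt_trans bk|exact: bC].
apply: filterS => p lek; apply/lee_addgt0Pr => e e0.
pose k := Num.truncn e^-1.
apply: (le_trans (lek k)); rewrite lee_fin lerD2l.
by rewrite -[leRHS]invrK lef_pV2 ?posrE ?invr_gt0// ltW// truncnS_gt.
Qed.
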